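(* Let $a+bi \in \mathbb{Z}[i]$ be nonzero. Let $j$ be the largest integer such that $2^j$ divides both $a$ and $b$, and let $m \geq 0$ be the smallest integer such that $\frac{\max(|a|,|b|)}{2^j} \leq w_m - 2$. Then \[ \phi_{\mathbb{Z}[i]}(a+bi) = \begin{cases} m+2j & \text{if } \frac{|a|+|b|}{2^j} \leq w_{m+1}-3,\\ m+2j+1 & \text{if } \frac{|a|+|b|}{2^j} > w_{m+1}-3. \end{cases} \]
   Context: For an integral domain $R$, a Euclidean function is a map $f: R\setminus\{0\} \to \mathbb{N}_0 = \{0,1,2,\dots\}$ such that for all $a,b \in R\setminus\{0\}$ there exist $q,r\in R$ with $a = qb+r$ and either $r=0$ or $f(r)<f(b)$. For a Euclidean domain $R$, $\phi_R$ denotes its minimal Euclidean function, i.e. the pointwise minimum of all Euclidean functions on $R$ (which is itself a Euclidean function). $\mathbb{Z}[i]=\{a+bi : a,b\in\mathbb{Z}\}$ is the ring of Gaussian integers. For $n\geq 0$ define $w_n = 2^{k+1}+2^k$ if $n=2k$ and $w_n = 2^{k+2}$ if $n=2k+1$. *)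

(* Defs.v *)
From HB Require Import structures.
From mathcomp Require Import all_boot all_order all_algebra.
From mathcomp Require Import boolp classical_sets.
From mathcomp Require Import zify ring.

Set Implicit Arguments.
Unset Strict Implicit.
Unset Printing Implicit Defensive.

Import Order.TTheory GRing.Theory Num.Theory.
Local Open Scope classical_set_scope.
Local Open Scope ring_scope.

(* A Euclidean function is only defined on R \ {0}; here it is a total map whose
   value at 0 is unconstrained and never inspected. *)
Definition euclidean_function (R : idomainType) (f : R -> nat) : Prop :=
  forall a b : R, a != 0 -> b != 0 ->
    exists q r : R, a = q * b + r /\ (r = 0 \/ (f r < f b)%N).

Definition euclidean_values (R : idomainType) (x : R) : set nat :=
  [set n | exists2 f : R -> nat, euclidean_function f & f x = n].

(* The minimum of [euclidean_values x]; the default 0 is returned only if R has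
   no Euclidean function. *)
Definition min_euclidean (R : idomainType) (x : R) : nat :=
  xget 0%N [set n | euclidean_values x n /\
                    forall k, euclidean_values x k -> (n <= k)%N].

Lemma min_euclideanP (R : idomainType) (g : R -> nat) (x : R) :
  euclidean_function g ->
  euclidean_values x (min_euclidean x) /\
  forall k, euclidean_values x k -> (min_euclidean x <= k)%N.
Proof.
move=> Eg; have exP : exists n, `[< euclidean_values x n >].
  by exists (g x); apply/asboolP; exists g.
pose P := [set n : nat | euclidean_values x n /\
                   forall k, euclidean_values x k -> (n <= k)%N].
suff exmin : exists n, P n by exact: (xgetPex 0%N exmin).
case: (ex_minnP exP) => n /asboolP vn minn; exists n; split=> // k vk.
by apply: minn; apply/asboolP.
Qed.

Lemma min_euclidean_function (R : idomainType) (g : R -> nat) :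
  euclidean_function g -> euclidean_function (@min_euclidean R).
Proof.
move=> Eg a b a0 b0; have [[f Ef fb] _] := min_euclideanP b Eg.
have [q [r [-> fr]]] := Ef a b a0 b0; exists q, r; split=> //.
case: fr => [|fr]; [by left | right].
by rewrite -fb; apply: leq_ltn_trans fr; apply: (min_euclideanP r Eg).2; exists f.
Qed.

Record gaussInt := GaussInt { gre : int; gim : int }.

Definition gaussInt_pair (x : gaussInt) : int * int := (gre x, gim x).
Definition pair_gaussInt (p : int * int) : gaussInt := GaussInt p.1 p.2.
Lemma gaussInt_pairK : cancel gaussInt_pair pair_gaussInt.
Proof. by case. Qed.

HB.instance Definition _ := Countable.copy gaussInt (can_type gaussInt_pairK).

Definition gadd (x y : gaussInt) := GaussInt (gre x + gre y) (gim x + gim y).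
Definition gopp (x : gaussInt) := GaussInt (- gre x) (- gim x).
Definition gmul (x y : gaussInt) :=
  GaussInt (gre x * gre y - gim x * gim y) (gre x * gim y + gim x * gre y).

Lemma gaddA : associative gadd.
Proof. by move=> [a b] [c d] [e f]; rewrite /gadd /= !addrA. Qed.
Lemma gaddC : commutative gadd.
Proof. by move=> [a b] [c d]; congr GaussInt; rewrite /= addrC. Qed.
Lemma gadd0 : left_id (GaussInt 0 0) gadd.
Proof. by move=> [a b]; rewrite /gadd /= !add0r. Qed.
Lemma gaddN : left_inverse (GaussInt 0 0) gopp gadd.
Proof. by move=> [a b]; rewrite /gadd /= !addNr. Qed.

HB.instance Definition _ :=
  GRing.isZmodule.Build gaussInt gaddA gaddC gadd0 gaddN.

Lemma gmulA : associative gmul.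
Proof. by move=> [a b] [c d] [e f]; congr GaussInt => /=; ring. Qed.
Lemma gmulC : commutative gmul.
Proof. by move=> [a b] [c d]; congr GaussInt => /=; ring. Qed.
Lemma gmul1 : left_id (GaussInt 1 0) gmul.
Proof. by move=> [a b]; congr GaussInt => /=; ring. Qed.
Lemma gmulDl : left_distributive gmul gadd.
Proof. by move=> [a b] [c d] [e f]; congr GaussInt => /=; ring. Qed.
Lemma g1_neq0 : GaussInt 1 0 != 0.
Proof. by []. Qed.

HB.instance Definition _ :=
  GRing.Zmodule_isComNzRing.Build gaussInt gmulA gmulC gmul1 gmulDl g1_neq0.

Definition gnorm (x : gaussInt) : int := gre x ^+ 2 + gim x ^+ 2.

Lemma gnormM (x y : gaussInt) : gnorm (x * y) = gnorm x * gnorm y.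
Proof. by case: x y => [a b] [c d]; rewrite /gnorm /=; ring. Qed.

Lemma gnorm_ge0 (x : gaussInt) : 0 <= gnorm x.
Proof. by rewrite addr_ge0 ?sqr_ge0. Qed.

Lemma gnorm_eq0 (x : gaussInt) : (gnorm x == 0) = (x == 0).
Proof.
case: x => a b; rewrite /gnorm paddr_eq0 ?sqr_ge0 // !sqrf_eq0 /=.
by apply/andP/eqP => [[/eqP-> /eqP->] //|[-> ->]].
Qed.

Definition gunit : pred gaussInt := fun x => gnorm x == 1.
Definition ginv (x : gaussInt) : gaussInt :=
  if gunit x then GaussInt (gre x) (- gim x) else x.

Lemma gmulV : {in gunit, left_inverse 1 ginv *%R}.
Proof.
move=> x; rewrite /ginv => Ux; rewrite [gunit x]Ux; move/eqP: Ux.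
case: x => a b; rewrite /gnorm /= => ab1.
rewrite -[1]/(GaussInt 1 0) -ab1; congr GaussInt => /=; ring.
Qed.

Lemma gunitPl (x y : gaussInt) : y * x = 1 -> gunit x.
Proof.
move=> /(congr1 gnorm); rewrite gnormM => yx.
have := gnorm_ge0 x; have := gnorm_ge0 y; rewrite /gunit.
have {yx} : gnorm y * gnorm x = 1 by [].
case: (gnorm x) (gnorm y) => [m|m] [n|n] // /eqP.
by rewrite -PoszM eqz_nat muln_eq1 => /andP[_ m1].
Qed.

Lemma ginv_out : {in [predC gunit], ginv =1 id}.
Proof. by move=> x; rewrite inE /= /ginv => /negbTE nUx; rewrite [gunit x]nUx. Qed.

HB.instance Definition _ :=
  GRing.ComNzRing_hasMulInverse.Build gaussInt gmulV gunitPl ginv_out.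

Lemma gaussInt_idomain : GRing.integral_domain_axiom gaussInt.
Proof.
move=> x y /(congr1 gnorm)/eqP; rewrite gnormM.
by rewrite [gnorm 0]/(0 : int) mulf_eq0 !gnorm_eq0.
Qed.

HB.instance Definition _ :=
  GRing.ComUnitRing_isIntegral.Build gaussInt gaussInt_idomain.

Definition gaussi : gaussInt := GaussInt 0 1.

Lemma gaussi_sqr : gaussi ^+ 2 = -1.
Proof. by []. Qed.

Lemma gaussInt_intr (a : int) : a%:~R = GaussInt a 0.
Proof.
have natE (n : nat) : n%:R = GaussInt n%:Z 0.
  by elim: n => // n IHn; rewrite -natr1 IHn; congr GaussInt => /=; lia.
case: a => n; first exact: natE.
by rewrite NegzE mulrNz [n.+1%:~R]natE; congr GaussInt; rewrite /= oppr0.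
Qed.

Lemma gaussIntE (a b : int) : a%:~R + b%:~R * gaussi = GaussInt a b.
Proof. by rewrite !gaussInt_intr; congr GaussInt => /=; ring. Qed.

Definition w (n : nat) : nat :=
  if odd n then (2 ^ (n./2 + 2))%N else (2 ^ (n./2 + 1) + 2 ^ n./2)%N.

(* Main.v *)
(** Let O n be the set of nonzero z such that, for every power 2^k dividing z,
    the point z / 2^k lies in the octagon max <= w_(n-2k) - 2,
    |x| + |y| <= w_(n-2k+1) - 3 (and 2k <= n).  The minimal Euclidean function is
    the first n with z in O n; the closed formula is read off at the largest k.

    Lower bound: let f be Euclidean and b nonzero.  Write b = (1+i)c + u with
    u = 0 or 1, and divide c = qb + r with f r < f b.  Then (1+i)r + u = sb with
    s = 1 - (1+i)q nonzero.  Since z |-> (1+i)z + u maps O n into O (n+1), and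
    O n is stable under taking divisors, b lies in O (f b) by induction.

    Upper bound: every class modulo b in O n must meet O (n-1) or contain 0.
    If 1+i divides b, divide by 1+i and use induction.  If not, take a residue r
    in the square centred at 0 with sides b and ib.  If r is not in O (n-1), then
    r is even and sits next to the boundary of an octagon of its own scale, and
    moving it by a unit multiple of b gives an odd element of O (n-1). *)
Require Import Defs.
From mathcomp Require Import all_boot all_order all_algebra.
From mathcomp Require Import boolp zify ring.

Import Order.TTheory GRing.Theory Num.Theory.
Local Open Scope ring_scope.

(** * The sequence [w] and the octagons *)

Lemma wSS n : w n.+2 = (2 * w n)%N.
Proof. by rewrite /w /= negbK; case: odd; rewrite ?addSn !expnS; ring. Qed.

(** In this form comparisons of consecutive terms are linear in one scale [t], so [lia] settles them
    without meeting powers of 2. *)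
Lemma w_cases n : exists2 t : nat, (0 < t)%N &
  w n = (3 * t)%N /\ w n.+1 = (4 * t)%N \/ w n = (4 * t)%N /\ w n.+1 = (6 * t)%N.
Proof.
elim: n => [|n [t t0 IHn]]; first by exists 1%N => //; left; split.
by case: IHn => -[wn wSn]; [exists t | exists (2 * t)%N]; rewrite ?wSS ?wn ?wSn; lia.
Qed.

Lemma w_addM j n : w (n + 2 * j) = (2 ^ j * w n)%N.
Proof.
elim: j n => [|j IHj] n; first by rewrite mul1n muln0 addn0.
by rewrite mulnS addnA IHj addn2 wSS expnS; ring.
Qed.

(** The margins 2 and 3 stand on the left because subtraction in [nat] truncates. *)
Definition in_oct (W V : nat) (x y : int) : bool :=
  [&& (`|x| + 2 <= W)%N, (`|y| + 2 <= W)%N & (`|x| + `|y| + 3 <= V)%N].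

(** Quantifying over all [k] keeps the valuation of [z] out of the definition and excludes 0, which
    every power of 2 divides. *)
Definition oct (n : nat) (z : gaussInt) : Prop :=
  forall (k : nat) (x y : int), z = GaussInt (2 ^+ k * x) (2 ^+ k * y) ->
    (2 * k <= n)%N /\ in_oct (w (n - 2 * k)) (w (n - 2 * k).+1) x y.

(** * Moving a residue into an octagon by a unit multiple of b *)

(* K is the power of 2 dividing x + yi.  Multiples of K are compared with K only
   through the case distinctions below, which keeps the statement linear; the
   last one says that x + yi lies outside the octagon at scale K. *)
Lemma shift_in_oct (W V : nat) (K t p q c x y x' y' : int) :
  2 <= K -> K <= t ->
  (W%:Z = 3 * t /\ V%:Z = 4 * t \/ W%:Z = 4 * t /\ V%:Z = 6 * t) ->
  0 <= y -> y <= x -> q < p -> - q < p -> in_oct V (2 * W)%N p q ->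
  p + q = 2 * c + 1 -> x = 2 * x' -> y = 2 * y' ->
  x + y < p -> 2 * x <= p + `|q| ->
  [\/ y = 0, y = K | 2 * K <= y] ->
  [\/ y = x, y = x - K | y <= x - 2 * K] ->
  x = W%:Z - K \/ x <= W%:Z - 2 * K ->
  [\/ x = W%:Z - K /\ x + y <= V%:Z - 3 * K, x + y = V%:Z - K | x + y = V%:Z - 2 * K] ->
  in_oct W V (x - p) (y - q) || in_oct W V (x + q) (y - p).
Proof.
rewrite /in_oct => K2 Kt WV y0 yx qp nqp /and3P[p1 q1 pq1] pc xx yy xyp xpq hy hxy hxW hx.
case: (lerP 0 q) => q0.
  apply/orP; left.
  by case: WV => -[? ?]; (case: hx => [[? ?]|?|?]); apply/and3P; split; lia.
(* For [q < 0] all signs except that of [x + q] are determined; fixing them spares [lia] most case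
   splits. *)
have xpE : `|(x - p)%R|%N%:Z = p - x by lia.
have yqE : `|(y - q)%R|%N%:Z = y - q by lia.
have ypE : `|(y - p)%R|%N%:Z = p - y by lia.
have q'E : `|q|%N%:Z = - q by lia.
have [xqE|xqE] : `|(x + q)%R|%N%:Z = x + q \/ `|(x + q)%R|%N%:Z = - x - q by lia.
all: move: xpE yqE ypE q'E xqE pq1 q1 xpq; rewrite ltr0_norm //.
all: move: `|(x - p)%R|%N `|(y - q)%R|%N `|(y - p)%R|%N `|q|%N `|(x + q)%R|%N
  => xp yq yp q' xq xpE yqE ypE q'E xqE pq1 q1 xpq.
all: case: hx => [[ex exy]|exy|exy]; case: hxy => hxy; case: hxW => hxW; case: hy => hy;
  case: WV => -[? ?]; lia.
Qed.

(** Size forces X < u and X + Y < v, so a point outside the inner octagon has X = u - 1, or X + Y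
    equal to v - 1 or v - 2. Scaling by 2h gives the cases of [shift_in_oct]. *)
Lemma shift_in_oct_scaled (W V u v : nat) (h s p q c X Y : int) :
  0 < h -> 0 < s ->
  (u%:Z = 3 * s /\ v%:Z = 4 * s \/ u%:Z = 4 * s /\ v%:Z = 6 * s) ->
  W%:Z = 2 * h * u%:Z -> V%:Z = 2 * h * v%:Z ->
  0 <= Y -> Y <= X -> q < p -> - q < p -> in_oct V (2 * W)%N p q ->
  p + q = 2 * c + 1 ->
  2 * h * X + 2 * h * Y < p -> 2 * (2 * h * X) <= p + `|q| ->
  ~~ in_oct u v X Y ->
  in_oct W V (2 * h * X - p) (2 * h * Y - q) || in_oct W V (2 * h * X + q) (2 * h * Y - p).
Proof.
move=> h0 s0 uv eW eV Y0 YX qp nqp pqV pc xyp xpq nXY.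
have /and3P[p1 q1 pq1] := pqV.
have K0 : 0 < 2 * h by lia.
have Xu : X < u%:Z.
  by rewrite -(ltr_pM2l K0) -eW; lia.
have XYv : X + Y < v%:Z.
  by rewrite -(ltr_pM2l K0) -eV mulrDr; lia.
have le (a b : int) : a <= b -> 2 * h * a <= 2 * h * b by rewrite (ler_pM2l K0).
apply: (@shift_in_oct W V (2 * h) (2 * h * s) p q c _ _ (h * X) (h * Y)) => //.
- lia.
- by have := le 1 s; lia.
- by case: uv => -[? ?]; [left | right]; split; nia.
- nia.
- exact: le.
- lia.
- lia.
- have [->|[->|Y2]] : Y = 0 \/ (Y = 1 \/ 2 <= Y) by lia.
  + by constructor 1; rewrite mulr0.
  + by constructor 2; rewrite mulr1.
  + by constructor 3; have := le _ _ Y2; lia.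
- have [->|[->|Y2]] : Y = X \/ (Y = X - 1 \/ Y <= X - 2) by lia.
  + by constructor 1.
  + by constructor 2; rewrite mulrBr mulr1.
  + by constructor 3; have := le _ _ Y2; lia.
- rewrite eW; have [->|Y2] : X = u%:Z - 1 \/ X <= u%:Z - 2 by lia.
  + by left; rewrite mulrBr mulr1.
  + by right; have := le _ _ Y2; lia.
- rewrite eW eV -mulrDr.
  have [[eX XY]|[->|->]] : (X = u%:Z - 1 /\ X + Y <= v%:Z - 3) \/
      (X + Y = v%:Z - 1 \/ X + Y = v%:Z - 2).
    by move: nXY; rewrite /in_oct; lia.
  + by constructor 1; split; [rewrite eX|have := le _ _ XY]; lia.
  + by constructor 2; lia.
  + by constructor 3; lia.
Qed.

(* The scale 2h = 2^k is so large that the octagon of size n - 2k does not exist. *)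
Lemma shift_in_oct_small (W V : nat) (h p q c X Y : int) :
  0 < h -> (W%:Z = 4 * h /\ V%:Z = 6 * h) \/ (W%:Z = 3 * h /\ V%:Z = 4 * h) ->
  0 <= Y -> Y <= X -> 0 < X -> q < p -> - q < p -> in_oct V (2 * W)%N p q ->
  p + q = 2 * c + 1 ->
  2 * h * X + 2 * h * Y < p -> 2 * (2 * h * X) <= p + `|q| ->
  in_oct W V (2 * h * X - p) (2 * h * Y - q) || in_oct W V (2 * h * X + q) (2 * h * Y - p).
Proof.
move=> h0 WV Y0 YX X0 qp nqp /and3P[p1 q1 pq1] pc xyp xpq.
have K0 : 0 < 2 * h by lia.
(* 4hX <= p + |q| <= 2W - 3 < 8h, so the residue can only be 2h or 2h(1 + i). *)
have X1 : X = 1.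
  apply/eqP; rewrite eq_le; apply/andP; split; last by [].
  by rewrite -ltzD1 -(ltr_pM2l K0); lia.
move: Y0 YX xyp xpq; rewrite X1 mulr1 => Y0 Y1 xyp xpq.
have [Y00|Y11] : Y = 0 \/ Y = 1 by lia.
- move: xyp; rewrite /in_oct Y00 mulr0; case: WV => -[? ?]; lia.
move: xyp; rewrite /in_oct Y11 mulr1; case: WV => -[? ?]; lia.
Qed.

Lemma in_octNl W V x y : in_oct W V (- x) y = in_oct W V x y.
Proof. by rewrite /in_oct abszN. Qed.

Lemma in_octNr W V x y : in_oct W V x (- y) = in_oct W V x y.
Proof. by rewrite /in_oct abszN. Qed.

Lemma in_octC W V x y : in_oct W V x y = in_oct W V y x.
Proof. by rewrite /in_oct andbCA (addnC `|x|%N `|y|%N). Qed.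

(* The symmetries of the square act on b = p + qi and x + yi together, and b may
   also be multiplied by i alone. *)
Lemma dihedral_ind (P : int -> int -> int -> int -> Prop) :
  (forall p q x y, P (- q) p x y -> P p q x y) ->
  (forall p q x y, P p (- q) x (- y) -> P p q x y) ->
  (forall p q x y, P q p y x -> P p q x y) ->
  (forall p q x y, `|q| <= p -> 0 <= y -> y <= x -> P p q x y) ->
  forall p q x y, P p q x y.
Proof.
move=> rot refl swap base.
have oct p q x y : 0 <= y -> y <= x -> P p q x y.
  move=> y0 yx; have [pq|] := lerP `|q| `|p|.
    have [p0|p0] := lerP 0 p; first by apply: base; lia.
    by apply/rot/rot/base; lia.
  have [q0|q0] := lerP 0 q; last by move=> pq; apply/rot/base; lia.
  by move=> pq; apply/rot/rot/rot/base; lia.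
have quad p q x y : 0 <= x -> 0 <= y -> P p q x y.
  move=> x0 y0; have [|xy] := lerP y x; first exact: oct.
  by apply/swap/oct => //; apply: ltW.
have half p q x y : 0 <= x -> P p q x y.
  move=> x0; have [|y0] := lerP 0 y; first exact: quad.
  by apply/refl/quad => //; lia.
move=> p q x y; have [|x0] := lerP 0 x; first exact: half.
by apply/swap/refl/swap/half; lia.
Qed.

(* With b = p + qi, the four points are z - b, z + b, z - ib and z + ib. *)
Definition some_shift_in_oct (W V : nat) (p q x y : int) : bool :=
  [|| in_oct W V (x - p) (y - q), in_oct W V (x + p) (y + q),
     in_oct W V (x + q) (y - p) | in_oct W V (x - q) (y + p)].

(** Both alternatives, with or without an octagon at scale 2h, are invariant under the symmetries of
    the square, so one reduction to 0 <= Y <= X and |q| <= p serves both. *)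
Lemma some_shift_in_oct_scaled (W V u v : nat) (h s : int) :
  0 < h -> forall p q X Y : int,
  [/\ 0 < s, u%:Z = 3 * s /\ v%:Z = 4 * s \/ u%:Z = 4 * s /\ v%:Z = 6 * s,
    W%:Z = 2 * h * u%:Z, V%:Z = 2 * h * v%:Z & ~~ in_oct u v X Y]
   \/ (W%:Z = 4 * h /\ V%:Z = 6 * h \/ W%:Z = 3 * h /\ V%:Z = 4 * h) ->
  in_oct V (2 * W)%N p q ->  (exists c, p + q = 2 * c + 1) -> X != 0 \/ Y != 0 ->
  `|2 * h * X| + `|2 * h * Y| < Num.max `|p| `|q| ->
  2 * Num.max `|2 * h * X| `|2 * h * Y| <= `|p| + `|q| ->
  some_shift_in_oct W V p q (2 * h * X) (2 * h * Y).
Proof.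
move=> h0; apply: dihedral_ind => p q X Y.
- move=> IH D pq [c pc] XY b1 b2.
  have : some_shift_in_oct W V (- q) p (2 * h * X) (2 * h * Y).
    apply: IH => //; [by rewrite in_octNl in_octC | by exists (c - q); lia | lia..].
  by rewrite /some_shift_in_oct !opprK; case/or4P => ->; rewrite ?orbT.
- move=> IH D pq [c pc] XY b1 b2.
  have : some_shift_in_oct W V p (- q) (2 * h * X) (2 * h * - Y).
    apply: IH; rewrite ?mulrN ?normrN ?in_octNr ?oppr_eq0 //.
    by exists (c - q); lia.
  rewrite /some_shift_in_oct mulrN -(in_octNr _ _ _ (2 * h * Y - q)).
  rewrite -(in_octNr _ _ _ (2 * h * Y + q)).
  rewrite -(in_octNr _ _ _ (2 * h * Y - p)) -(in_octNr _ _ _ (2 * h * Y + p)) !opprD !opprK.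
  by case/or4P => ->; rewrite ?orbT.
- move=> IH D pq [c pc] XY b1 b2.
  have : some_shift_in_oct W V q p (2 * h * Y) (2 * h * X).
    apply: IH; rewrite ?(in_octC _ _ Y) ?(in_octC _ _ q) //; try lia.
    by exists c; lia.
  by rewrite /some_shift_in_oct !(in_octC _ _ (2 * h * Y + _));
    case/or4P => ->; rewrite ?orbT.
move=> qp Y0 YX D pq [c pc] XY.
have K0 : 0 <= 2 * h by lia.
have X0 : 0 <= X by lia.
rewrite !(ger0_norm (mulr_ge0 K0 _)) // => b1 b2.
have X'Y' : 2 * h * Y <= 2 * h * X by rewrite ler_wpM2l.
suff : in_oct W V (2 * h * X - p) (2 * h * Y - q) || in_oct W V (2 * h * X + q) (2 * h * Y - p).
  by rewrite /some_shift_in_oct => /orP[] ->; rewrite ?orbT.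
(* [p + q] is odd, so |q| = p is impossible. *)
have ? : q < p by lia.
have ? : - q < p by lia.
have ? : 2 * h * X + 2 * h * Y < p by lia.
have ? : 2 * (2 * h * X) <= p + `|q| by lia.
case: D => [[s0 uv eW eV nXY]|WV].
- exact: (@shift_in_oct_scaled W V u v h s p q c).
- by apply: (@shift_in_oct_small W V h p q c) => //; lia.
Qed.

(** * Dividing out powers of 2 *)

Lemma parity (x : int) : exists x', x = 2 * x' \/ x = 2 * x' + 1.
Proof. by exists (x %/ 2)%Z; lia. Qed.

Definition not_both_even (x y : int) : Prop :=
  forall x' y' : int, ~ (x = 2 * x' /\ y = 2 * y').

Lemma gauss_valuation (z : gaussInt) : z != 0 ->
  exists (j : nat) (x y : int),
    z = GaussInt (2 ^+ j * x) (2 ^+ j * y) /\ not_both_even x y.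
Proof.
case: z => a b; have [n] := ubnP (`|a| + `|b|)%N.
elim: n a b => // n IHn a b leab z0.
have [[x [y [ax bey]]]|odd_ab] :
    (exists x y : int, a = 2 * x /\ b = 2 * y) \/ not_both_even a b.
- have [[x [ax|ax]] [y [bey|bey]]] := (parity a, parity b); last 3 first.
  1-3: by right=> x' y'; lia.
  by left; exists x, y.
- have xy0 : GaussInt x y != 0.
    by apply: contraNneq z0 => -[x0 y0]; rewrite ax bey x0 y0.
  have ab0 : (`|a| + `|b| != 0)%N.
    by apply: contraNneq z0 => ab0; apply/eqP; congr GaussInt; lia.
  have [|j [x1 [y1 [[xE yE] odd_xy]]]] := IHn x y _ xy0; first by lia.
  by exists j.+1, x1, y1; rewrite ax bey xE yE !mulrA -exprS.
by exists 0%N, a, b; rewrite !mul1r.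
Qed.

Lemma in_octM n d x y : in_oct (w n) (w n.+1) x y ->
  in_oct (w (n + 2 * d)) (w (n + 2 * d).+1) (2 ^+ d * x) (2 ^+ d * y).
Proof.
rewrite -addSn !w_addM /in_oct !abszM abszX.
have : (0 < 2 ^ d)%N by rewrite expn_gt0.
by move: (2 ^ d)%N => D D0; nia.
Qed.

(** By [in_octM] the condition at the exact power of 2 implies those at all smaller powers, and no
    larger power divides. *)
Lemma oct_valuation n j x y : not_both_even x y ->
  oct n (GaussInt (2 ^+ j * x) (2 ^+ j * y)) <->
  (2 * j <= n)%N /\ in_oct (w (n - 2 * j)) (w (n - 2 * j).+1) x y.
Proof.
move=> odd_xy; split=> [/(_ j x y erefl) // | [lejn xyn]] k x1 y1 [ex ey].
have p0 i : (2 : int) ^+ i != 0 by rewrite expf_neq0.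
have [lekj|ltjk] := leqP k j; last first.
  case: (odd_xy (2 ^+ (k - j.+1) * x1) (2 ^+ (k - j.+1) * y1)).
  by split; apply: (mulfI (p0 j)); rewrite ?ex ?ey !mulrA -exprSr -exprD; congr (_ ^+ _ * _); lia.
move: ex ey; rewrite -(subnKC lekj) !exprD -!mulrA => /(mulfI (p0 k)) <- /(mulfI (p0 k)) <-.
split; first by lia.
have -> : (n - 2 * k = n - 2 * j + 2 * (j - k))%N by lia.
exact: in_octM.
Qed.

Lemma oct_neq0 n : ~ oct n 0.
Proof. by move=> /(_ n.+1 0 0) []; rewrite ?mulr0 //; lia. Qed.

Lemma octS n z : oct n z -> oct n.+1 z.
Proof.
move=> zn k x y /zn [lekn]; rewrite subSn // => xyn; split; first by lia.
by have [t t0 tw] := w_cases (n - 2 * k); move: xyn; rewrite /in_oct wSS; lia.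
Qed.

Lemma oct_le m n z : (m <= n)%N -> oct m z -> oct n z.
Proof. by move=> /subnKC <- zm; elim: (n - m)%N => [|d IHd];
  rewrite ?addn0 ?addnS //; apply: octS. Qed.

(** * Multiplication by 1 + i, and divisors *)

Definition gpi : gaussInt := GaussInt 1 1.

Lemma gpi_mul (x y : int) : gpi * GaussInt x y = GaussInt (x - y) (x + y).
Proof. by congr GaussInt => /=; ring. Qed.

(** The new maximum is |x| + |y| and the new sum is 2 max(|x|, |y|), while [w n.+2] is [2 * w n], so
    the two constraints trade places. Since w_k is even for k > 0, parity reconciles the margins 2
    and 3. *)
Lemma oct_gpi n z : oct n.+1 (gpi * z) <-> oct n z.
Proof.
have [->|z0] := eqVneq z 0; first by rewrite mulr0; split=> /oct_neq0.
have [j [x [y [-> odd_xy]]]] := gauss_valuation _ z0.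
rewrite gpi_mul -mulrBr -mulrDr (oct_valuation _ _ _ _ odd_xy).
have [[x' xE] [y' yE]] := (parity x, parity y).
have [[c cE]|[c cE]] : (exists c, x + y = 2 * c + 1) \/ (exists c, x + y = 2 * c).
- by have [c [cE|cE]] := parity (x + y); [right|left]; exists c.
- rewrite oct_valuation; last by move=> u v; lia.
  have [lejn|] := leqP (2 * j) n; last first.
    split=> [[lejn]|[]]; last by lia.
    have -> : (n.+1 - 2 * j = 0)%N by lia.
    by rewrite /in_oct /w /=; lia.
  rewrite subSn //; have [t t0 tw] := w_cases (n - 2 * j).
  rewrite wSS /in_oct; split=> -[_ xyn]; split; lia.
(* Now x and y are both odd: the product gains a factor 2, and the quotient (x - c) + ci is tested
   at level n - 2j - 1. *)
have odd2 : not_both_even (x - c) c.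
  move=> u v [uE vE]; case: (odd_xy (u + v) (v - u)); lia.
have -> : x - y = 2 * (x - c) by lia.
rewrite cE !mulrA -!exprSr oct_valuation //.
have xodd : exists x1, x = 2 * x1 + 1.
  case: xE => xE; last by exists x'.
  by case: (odd_xy x' (c - x')); lia.
have [x1 x1E] := xodd.
split=> -[lejn].
  have -> : (n.+1 - 2 * j.+1 = (n - 2 * j).-1)%N by lia.
  case nj : (n - 2 * j)%N => [|m] /=; first by lia.
  by move=> xym; split; first lia; have [t t0 tw] := w_cases m; move: xym; rewrite wSS /in_oct; lia.
(* Two odd coordinates do not fit in the octagon of level 0. *)
have [jn|ltjn] := eqVneq (2 * j)%N n.
  by rewrite jn subnn /in_oct /w /=; lia.
have -> : (n - 2 * j = (n.+1 - 2 * j.+1).+1)%N by lia.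
move=> xym; split; first by lia.
by have [t t0 tw] := w_cases (n.+1 - 2 * j.+1); move: xym; rewrite wSS /in_oct; lia.
Qed.

(** The added 1 uses up exactly the slack: the old margin 3 on the sum becomes 2, and the doubled
    margin 4 on the maximum becomes 3. The new coordinates have opposite parity, so only k = 0
    matters. *)
Lemma oct_gpi1 n z : oct n z -> oct n.+1 (gpi * z + 1).
Proof.
case: z => x y /(_ 0%N x y); rewrite !mul1r subn0 => /(_ erefl)[_ xyn].
rewrite gpi_mul (_ : _ + 1 = GaussInt (2 ^+ 0 * (x - y + 1)) (2 ^+ 0 * (x + y))).
  rewrite oct_valuation; last by move=> u v; lia.
  rewrite muln0 subn0; split=> //.
  by have [t t0 tw] := w_cases n; move: xyn; rewrite wSS /in_oct; lia.
by congr GaussInt => /=; rewrite !mul1r ?addr0.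
Qed.

(** If 2^k divides b it divides sb, so both are compared at the same k. A unit s is a symmetry of
    the octagon. Otherwise the product P + Qi has P^2 + Q^2 >= 2(x^2 + y^2), whence max(|x|, |y|) <=
    max(|P|, |Q|) and |x| + |y| <= |P| + |Q|. *)
Lemma oct_divr n s b : s != 0 -> oct n (s * b) -> oct n b.
Proof.
case: s b => c d [p q] s0 sbn k x y [px qy].
case: (sbn k (c * x - d * y) (c * y + d * x)) => [|lekn xyn].
  by rewrite px qy; congr GaussInt => /=; ring.
split=> //; move: xyn; rewrite /in_oct.
have s_gt0 : 0 < c * c + d * d.
  have -> : c * c + d * d = Defs.gnorm (GaussInt c d) by rewrite /Defs.gnorm /=; ring.
  by rewrite lt_def gnorm_eq0 s0 gnorm_ge0.
move: (w _) (w _) => V W /and3P[P2 Q2 PQ3].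
have normPQ : (c * x - d * y) * (c * x - d * y) + (c * y + d * x) * (c * y + d * x) =
   (c * c + d * d) * (x * x + y * y) by ring.
have sqr_le (a e : int) : 0 <= e -> a * a <= e * e -> `|a| <= e.
  by move=> e0 ae; have [|ae'] := lerP `|a| e; nia.
have [s1|s2] : c * c + d * d = 1 \/ 2 <= c * c + d * d by lia.
- have : (c = 0 /\ (d = 1 \/ d = - 1)) \/ (d = 0 /\ (c = 1 \/ c = - 1)).
    by have : `|c| <= 1 /\ `|d| <= 1; [split; apply: sqr_le; nia | nia].
  by move=> [[cE [dE|dE]]|[dE [cE|cE]]]; move: P2 Q2 PQ3; rewrite cE dE; lia.
have big : 2 * (x * x + y * y) <= (c * c + d * d) * (x * x + y * y).
  by apply: ler_wpM2r => //; rewrite addr_ge0 // -expr2 sqr_ge0.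
move: normPQ big P2 Q2 PQ3; move: (c * x - d * y) (c * y + d * x) => P Q <- big P2 Q2 PQ3.
have PW : P * P <= (W%:Z - 2) * (W%:Z - 2) by nia.
have QW : Q * Q <= (W%:Z - 2) * (W%:Z - 2) by nia.
have xW : `|x| <= W%:Z - 2 by apply: sqr_le; nia.
have yW : `|y| <= W%:Z - 2 by apply: sqr_le; nia.
have PQV : P * P + Q * Q <= (V%:Z - 3) * (V%:Z - 3).
  have : 0 <= `|P| /\ 0 <= `|Q| by [].
  have -> : P * P = `|P| * `|P| by lia.
  have -> : Q * Q = `|Q| * `|Q| by lia.
  move=> []; have : `|P| + `|Q| <= V%:Z - 3 by lia.
  move: `|P| `|Q| (V%:Z - 3) => P' Q' T PQT P0 Q0.
  have : (P' + Q') * (P' + Q') <= T * T by apply: ler_pM; rewrite ?addr_ge0.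
  by have := mulr_ge0 P0 Q0; lia.
have xyV : `|(`|x| + `|y|)| <= V%:Z - 3.
  apply: sqr_le; first by lia.
  have ex : x * x = `|x| * `|x| by lia.
  have ey : y * y = `|y| * `|y| by lia.
  move: big; rewrite ex ey; move: `|x| `|y| => x' y' big.
  by have := sqr_ge0 (x' - y'); lia.
by lia.
Qed.

(** * Lower bound for every Euclidean function *)

Lemma gpi_div (z : gaussInt) : exists c, z = gpi * c \/ z = gpi * c + 1.
Proof.
case: z => x y; have [u [xy|xy]] := parity (x + y).
  exists (GaussInt u (y - u)); left.
  by rewrite gpi_mul; congr GaussInt; lia.
exists (GaussInt u (y - u)); right.
by rewrite gpi_mul; congr GaussInt => /=; rewrite ?addr0; lia.
Qed.

Lemma gpi_mul_neq1 z : gpi * z != 1.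
Proof. by case: z => x y; apply/eqP; rewrite gpi_mul => -[]; lia. Qed.

Lemma oct01 : oct 0 1.
Proof.
have odd10 : not_both_even 1 0 by move=> u v; lia.
by have [_] := oct_valuation 0 0 1 0 odd10; apply.
Qed.

Lemma euclidean_oct (f : gaussInt -> nat) (b : gaussInt) :
  euclidean_function f -> b != 0 -> oct (f b) b.
Proof.
move=> Ef; have [n] := ubnP (f b); elim: n b => // n IHn b fb b0.
have [c bc] := gpi_div b.
have [c0|c0] := eqVneq c 0.
  move: bc b0; rewrite c0 mulr0 add0r => -[->|->]; first by rewrite eqxx.
  by move=> _; apply: oct_le oct01.
have [q [r [cE r_small]]] := Ef c b c0 b0.
have s0 : 1 - gpi * q != 0 by rewrite subr_eq0 eq_sym gpi_mul_neq1.
have sb u : b = gpi * c + u -> (1 - gpi * q) * b = gpi * r + u.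
  by move=> bE; rewrite mulrBl mul1r {1}bE cE; ring.
(* If r = 0 then sb = u, which forces u = 1 and makes b a divisor of 1. *)
have [r0|r0] := eqVneq r 0.
  case: bc => [bc|/sb].
    have : (1 - gpi * q) * b == 0 by rewrite (sb 0) ?addr0 // r0 mulr0.
    by rewrite mulf_eq0 (negPf s0) (negPf b0).
  rewrite r0 mulr0 add0r => sb1.
  by apply: oct_le (oct_divr _ _ _ s0 _); last by rewrite sb1; apply: oct01.
case: r_small => [/eqP|fr]; first by rewrite (negPf r0).
have rn : oct (f r) r by apply: IHn => //; lia.
apply: oct_le fr (oct_divr _ _ _ s0 _); case: bc => [bc|/sb ->].
  by rewrite (sb 0) ?addr0 //; apply/oct_gpi.
exact: oct_gpi1.
Qed.

(** * Upper bound: division with remainder in the octagons *)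

Lemma round_div (A N : int) : 0 < N -> exists e, `|2 * (A - e * N)| <= N.
Proof.
move=> N0; exists ((2 * A + N) %/ (2 * N))%Z.
have := divz_eq (2 * A + N) (2 * N).
have : (0 <= (2 * A + N) %% (2 * N))%Z by apply: modz_ge0; lia.
have : ((2 * A + N) %% (2 * N) < 2 * N)%Z by apply: ltz_pmod; lia.
by move: (_ %% _)%Z (_ %/ _)%Z => r e; lia.
Qed.

(* Reducing [a] into the square centred at 0 with sides [b] and [ib]. *)
Lemma square_residue (a : gaussInt) (p q c : int) : p + q = 2 * c + 1 ->
  exists z x y, [/\ a = z * GaussInt p q + GaussInt x y,
    `|x| + `|y| < Num.max `|p| `|q| & 2 * Num.max `|x| `|y| <= `|p| + `|q|].
Proof.
case: a => a1 a2 pq.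
have N0 : 0 < p * p + q * q by have := sqr_ge0 (p - q); have := sqr_ge0 (p + q); nia.
(* The numerators are the real and imaginary parts of a times the conjugate of p + qi; rounding
   gives the quotient e + fi. *)
have [e eP] := round_div (a1 * p + a2 * q) _ N0.
have [f fP] := round_div (a2 * p - a1 * q) _ N0.
pose x := a1 - (e * p - f * q); pose y := a2 - (e * q + f * p).
exists (GaussInt e f), x, y.
have xE : a1 * p + a2 * q - e * (p * p + q * q) = x * p + y * q by rewrite /x /y; ring.
have yE : a2 * p - a1 * q - f * (p * p + q * q) = y * p - x * q by rewrite /x /y; ring.
split; first by congr GaussInt; rewrite /x /y /=; ring.
- move: eP fP; rewrite xE yE => eP fP.
  (* An odd norm makes the rounding inequality strict. *)
  have Nodd : p * p + q * q = 2 * (2 * c * c + 2 * c - p * q) + 1.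
    have -> : p * p + q * q = (p + q) * (p + q) - 2 * (p * q) by ring.
    by rewrite pq; ring.
  have bnd (u v t : int) : `|u| != 0 ->
      t * (p * p + q * q) = u * (x * p + y * q) + v * (y * p - x * q) ->
      2 * `|t| < `|u| + `|v|.
    move=> u0 tE; rewrite -(ltr_pM2r N0); move: N0 Nodd eP fP tE.
    move: (p * p + q * q) (x * p + y * q) (y * p - x * q) => N A B N0 Nodd eP fP tE.
    have tN : `|t| * N <= `|u| * `|A| + `|v| * `|B|.
      by rewrite -{1}(gtr0_norm N0) -!normrM tE ler_normD.
    have : `|u| * (2 * `|A|) < `|u| * N by rewrite ltr_pM2l; lia.
    have : `|v| * (2 * `|B|) <= `|v| * N by rewrite ler_wpM2l //; lia.
    by lia.
  (* |x| + |y| is the larger of |x + y| and |x - y|, and |p + q| + |p - q| is 2 max(|p|, |q|). *)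
  have b1 : 2 * `|x + y| < `|p + q| + `|p - q|.
    by apply: bnd; [lia | ring].
  have b2 : 2 * `|x - y| < `|p - q| + `|- p - q|.
    by apply: bnd; [lia | ring].
  by lia.
- move: eP fP; rewrite xE yE => eP fP.
  have bnd (u v t : int) : t * (p * p + q * q) = u * (x * p + y * q) + v * (y * p - x * q) ->
      2 * `|t| <= `|u| + `|v|.
    move=> tE; rewrite -(ler_pM2r N0); move: N0 eP fP tE.
    move: (p * p + q * q) (x * p + y * q) (y * p - x * q) => N A B N0 eP fP tE.
    have tN : `|t| * N <= `|u| * `|A| + `|v| * `|B|.
      by rewrite -{1}(gtr0_norm N0) -!normrM tE ler_normD.
    have : `|u| * (2 * `|A|) <= `|u| * N by rewrite ler_wpM2l //; lia.
    have : `|v| * (2 * `|B|) <= `|v| * N by rewrite ler_wpM2l //; lia.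
    by lia.
  have bnd_x : 2 * `|x| <= `|p| + `|- q| by apply: bnd; ring.
  have bnd_y : 2 * `|y| <= `|q| + `|p| by apply: bnd; ring.
  by lia.
Qed.

Lemma expn2_intr k : (2 ^ k)%N%:Z = 2 ^+ k.
Proof. by elim: k => // k IHk; rewrite expnS PoszM IHk exprS. Qed.

Lemma w0 : w 0%N = 3%N. Proof. by []. Qed.
Lemma w1 : w 1%N = 4%N. Proof. by []. Qed.
Lemma w_le m n : (m <= n)%N -> (w m <= w n)%N.
Proof.
move=> /subnKC <-; elim: (n - m)%N => [|d IHd]; rewrite ?addn0 // addnS.
by have [t t0 tw] := w_cases (m + d); lia.
Qed.

(** A residue not divisible by 2 meets both bounds of level n by size alone, so this one is 2^(k+1)
    times X + Yi. If 2(k+1) <= n it lies outside the octagon at that scale; otherwise size leaves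
    only n = 2k and n = 2k + 1. *)
Lemma some_shift_in_oct_residue n p q c x y : in_oct (w n.+1) (w n.+2) p q -> p + q = 2 * c + 1 ->
  `|x| + `|y| < Num.max `|p| `|q| -> 2 * Num.max `|x| `|y| <= `|p| + `|q| ->
  x != 0 \/ y != 0 -> ~ oct n (GaussInt x y) ->
  some_shift_in_oct (w n) (w n.+1) p q x y /\ exists e, x + y = 2 * e.
Proof.
move=> pqn pq xyp xpq xy0 nxy.
have z0 : GaussInt x y != 0.
  by apply/eqP => -[x0 y0]; move: xy0; rewrite x0 y0; case.
have [[|k] [X [Y [[xE yE] odd_XY]]]] := gauss_valuation _ z0.
  case: nxy; rewrite xE yE oct_valuation // muln0 subn0; split=> //.
  by move: xyp xpq pqn; rewrite xE yE !mul1r wSS /in_oct; lia.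
have XY0 : X != 0 \/ Y != 0.
  by case: xy0; rewrite ?xE ?yE mulf_eq0 negb_or => /andP[_]; [left | right].
have h0 : 0 < (2 : int) ^+ k by rewrite exprn_gt0.
move: nxy; rewrite xE yE oct_valuation // => nxy.
split; last by exists (2 ^+ k * (X + Y)); rewrite exprS; ring.
move: xyp xpq; rewrite xE yE !exprS => xyp xpq; move: pqn; rewrite wSS => pqn.
(* A nonzero multiple of 2^(k+1) has a coordinate of size at least 2^(k+1), too large for such a
   small n. *)
have W4 : (w n.+2 <= w (1 + 2 * k))%N -> False.
  rewrite w_addM wSS => W4.
  have h1 : 2 * 2 ^+ k <= Num.max `|2 * 2 ^+ k * X| `|2 * 2 ^+ k * Y|.
    rewrite le_max; move: (2 ^+ k) h0 => h h0.
    by case: XY0 => ?; apply/orP; [left | right]; rewrite normrM ger0_norm ?ler_peMr; lia.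
  move: W4 xpq h1 pqn => + + + /and3P[_ _]; rewrite w1 -lez_nat !PoszM expn2_intr.
  by move: (Num.max `|_ * X| _) => M; move: (2 ^+ k) => h; lia.
have [lekn|ltnk] := leqP (2 * k.+1) n.
  have [t t0 tw] := w_cases (n - 2 * k.+1).
  apply: (@some_shift_in_oct_scaled _ _ (w (n - 2 * k.+1)) (w (n - 2 * k.+1).+1) _ t%:Z) => //;
    last by exists c.
  left; split; [by lia | by lia | | | by apply/negP => nn; apply: nxy].
    by rewrite -{1}(subnK lekn) w_addM PoszM expn2_intr exprS.
  by rewrite -{1}(subnK lekn) -addSn w_addM PoszM expn2_intr exprS.
(* No octagon exists at this scale; the zeros are placeholders for it. *)
apply: (@some_shift_in_oct_scaled _ _ 0 0 _ 0) => //; last by exists c.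
right; have [nk|] := eqVneq n (1 + 2 * k)%N.
  left; rewrite nk -addSn !w_addM w1 wSS w0 !PoszM expn2_intr; lia.
have [nk|nk1 nk2] := eqVneq n (0 + 2 * k)%N.
  right; rewrite nk -addSn !w_addM w1 w0 !PoszM expn2_intr; lia.
by case: W4; apply: w_le; lia.
Qed.

Lemma oct_odd n x y e : x + y = 2 * e + 1 -> in_oct (w n) (w n.+1) x y ->
  oct n (GaussInt x y).
Proof.
move=> xy xyn; rewrite -[x]mul1r -[y]mul1r -(expr0 2).
by rewrite oct_valuation; [rewrite muln0 subn0 | move=> u v; lia].
Qed.

Lemma oct_euclidean n b : oct n b -> forall a, exists q r,
  a = q * b + r /\ (r = 0 \/ exists2 m, (m < n)%N & oct m r).
Proof.
elim: n b => [|n IHn] b bn a.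
  have b0 : b != 0 by apply: contraPneq bn => ->; apply: oct_neq0.
  case: b bn b0 => x y /(_ 0%N x y); rewrite !mul1r /= => /(_ erefl)[_ xy] xy0.
  (* Apart from 0, the octagon of level 0 holds only units, whose inverses are their conjugates. *)
  exists (a * GaussInt x (- y)), 0; split; last by left.
  rewrite addr0 -mulrA (_ : _ * GaussInt x y = 1) ?mulr1 //.
  have : (x = 0 /\ (y = 1 \/ y = - 1)) \/ (y = 0 /\ (x = 1 \/ x = - 1)).
    have : x != 0 \/ y != 0.
      by apply/orP; rewrite -negb_and; apply: contra xy0 => /andP[/eqP-> /eqP->].
    by move: xy; rewrite w1 w0 /in_oct; lia.
  by move=> [[-> [->|->]]|[-> [->|->]]].
(* If 1 + i divides b, write a = (1 + i)a' + u and lift the remainder r of a' to (1 + i)r + u. *)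
have [c [bE|bE]] := gpi_div b.
  move: bn; rewrite bE => /oct_gpi cn; have [a' aE] := gpi_div a.
  have [q [r [a'E r_small]]] := IHn c cn a'.
  have aE' u : a = gpi * a' + u -> a = q * (gpi * c) + (gpi * r + u).
    by rewrite a'E => ->; ring.
  case: r_small => [r0|[m ltmn rm]].
    rewrite r0 mulr0 in aE'; exists q.
    case: aE => aE; last first.
      exists (0 + 1); split; [exact: aE' | right].
      by exists 0%N; rewrite ?add0r //; apply: oct01.
    by exists 0; split; [rewrite -[RHS]addr0 -addrA; apply: aE'; rewrite addr0 | left].
  exists q; case: aE => aE.
    exists (gpi * r); split; first by rewrite -[gpi * r]addr0; apply: aE'; rewrite addr0.
    by right; exists m.+1 => //; apply/oct_gpi.
  exists (gpi * r + 1); split; first exact: aE'.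
  by right; exists m.+1 => //; apply: oct_gpi1.
case: c bE => c1 c2; rewrite gpi_mul => bE.
have [p [q [bpq pq]]] : exists p q, b = GaussInt p q /\ p + q = 2 * c1 + 1.
  exists (c1 - c2 + 1), (c1 + c2); rewrite bE.
  by split; [congr GaussInt => /=; rewrite addr0 | lia].
have pqn : in_oct (w n.+1) (w n.+2) p q.
  by have [] := bn 0%N p q _; rewrite ?bpq ?mul1r.
have [z [x [y [aE xyp xpq]]]] := square_residue a _ _ _ pq.
have [xyn|xyn] := pselect (oct n (GaussInt x y)).
  by exists z, (GaussInt x y); rewrite bpq; split=> //; right; exists n.
have [x0|x0] := eqVneq (GaussInt x y) 0.
  by exists z, 0; rewrite bpq -x0; split=> //; left.
have xy0 : x != 0 \/ y != 0.
  by apply/orP; rewrite -negb_and; apply: contra x0 => /andP[/eqP-> /eqP->].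
(* Since x + y is even and p + q odd, the shifted residue has an odd coordinate sum, and [oct_odd]
   asks only for the octagon at scale 1. *)
have [xy_shift [e xyE]] := some_shift_in_oct_residue _ _ _ _ _ _ pqn pq xyp xpq xy0 xyn.
rewrite aE bpq; case/or4P: xy_shift => cl.
- exists (z + 1), (GaussInt (x - p) (y - q)).
  split; first by congr GaussInt => /=; ring.
  by right; exists n => //; apply: (oct_odd _ _ _ (e - c1 - 1)) => //; lia.
- exists (z - 1), (GaussInt (x + p) (y + q)).
  split; first by congr GaussInt => /=; ring.
  by right; exists n => //; apply: (oct_odd _ _ _ (e + c1)) => //; lia.
- exists (z + gaussi), (GaussInt (x + q) (y - p)).
  split; first by congr GaussInt => /=; ring.
  by right; exists n => //; apply: (oct_odd _ _ _ (e + q - c1 - 1)) => //; lia.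
- exists (z - gaussi), (GaussInt (x - q) (y + p)).
  split; first by congr GaussInt => /=; ring.
  by right; exists n => //; apply: (oct_odd _ _ _ (e - q + c1)) => //; lia.
Qed.

(** * The minimal Euclidean function and the closed formula *)

Lemma ex_oct b : b != 0 -> exists n, oct n b.
Proof.
move=> /gauss_valuation [j [x [y [-> odd_xy]]]].
(* At level 2d the bounds are 3 * 2^d and 4 * 2^d, and 2^d > d. *)
pose d := (`|x| + `|y| + 3)%N; exists (2 * d + 2 * j)%N.
rewrite oct_valuation // addnK leq_addl -(add0n (2 * d)%N) -addSn !w_addM w0 w1.
by split=> //; have := ltn_expl d (isT : (1 < 2)%N); rewrite /in_oct /d; lia.
Qed.

Lemma min_euclidean_oct b : b != 0 ->
  oct (min_euclidean b) b /\ forall n, oct n b -> (min_euclidean b <= n)%N.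
Proof.
(* The disjunct [z == 0] gives 0 a default value, so that the least index is a total function. *)
have exP z : exists n, (z == 0) || `[< oct n z >].
  have [|/ex_oct[n zn]] := eqVneq z 0; first by exists 0%N.
  by exists n; apply/asboolP.
pose g z := ex_minn (exP z).
have g_oct z : z != 0 -> oct (g z) z.
  by rewrite /g; case: ex_minnP => n /orP[->|/asboolP].
have g_le z n : oct n z -> (g z <= n)%N.
  by rewrite /g => zn; case: ex_minnP => k _; apply; apply/orP; right; apply/asboolP.
have Eg : euclidean_function g.
  move=> a z _ z0; have [q [r [aE r_small]]] := oct_euclidean _ _ (g_oct z z0) a.
  exists q, r; split=> //; case: r_small => [|[m ltm rm]]; [by left | right].
  exact: leq_ltn_trans (g_le _ _ rm) ltm.
move=> b0; have [[f Ef fb] min_le] := min_euclideanP b Eg.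
split; first by rewrite -fb; apply: euclidean_oct.
by move=> n bn; apply: leq_trans (min_le _ _) (g_le _ _ bn); exists g.
Qed.

(** Turns the rational inequalities of the closed formula into integer ones. *)
Lemma scaled_intr_le (j : nat) (M : int) (v c : nat) :
  ((2 ^+ j * M)%:~R / 2 ^+ j <= v%:R - c%:R :> rat) = (M + c%:Z <= v%:Z).
Proof.
rewrite intrM rmorphXn mulrAC divff ?expf_neq0 // mul1r lerBrDr.
by rewrite !pmulrn -intrD ler_int.
Qed.

Theorem theorem1p2 (a b : int) (j m : nat)
  (ab_neq0 : a%:~R + b%:~R * gaussi != 0)
  (j_dvd : ((2 : int) ^+ j %| a)%Z /\ ((2 : int) ^+ j %| b)%Z)
  (j_max : forall k : nat,
     ((2 : int) ^+ k %| a)%Z -> ((2 : int) ^+ k %| b)%Z -> (k <= j)%N)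
  (m_ok : (Num.max `|a| `|b|)%:~R / 2 ^+ j <= (w m)%:R - 2 :> rat)
  (m_min : forall k : nat,
     (Num.max `|a| `|b|)%:~R / 2 ^+ j <= (w k)%:R - 2 :> rat -> (m <= k)%N) :
  min_euclidean (a%:~R + b%:~R * gaussi) =
    if (`|a| + `|b|)%:~R / 2 ^+ j <= (w m.+1)%:R - 3 :> rat
    then (m + 2 * j)%N
    else (m + 2 * j + 1)%N.
Proof.
have [[x aE] [y bE]] : (exists x, a = 2 ^+ j * x) /\ exists y, b = 2 ^+ j * y.
  by case: j_dvd => /dvdzP[x ->] /dvdzP[y ->]; split; eexists; rewrite mulrC.
have p0 : 0 <= (2 : int) ^+ j by rewrite exprn_ge0.
have odd_xy : not_both_even x y.
  move=> u v [xE yE]; suff: (j.+1 <= j)%N by rewrite ltnn.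
  by apply: j_max; rewrite ?aE ?bE ?xE ?yE mulrA -exprSr dvdz_mulr.
have maxE : Num.max `|a| `|b| = 2 ^+ j * Num.max `|x| `|y|.
  by rewrite aE bE !normrM ger0_norm // maxr_pMr.
have sumE : `|a| + `|b| = 2 ^+ j * (`|x| + `|y|).
  by rewrite aE bE !normrM ger0_norm // mulrDr.
have {}m_min k : Num.max `|x| `|y| + 2 <= (w k)%:Z -> (m <= k)%N.
  by move=> xyk; apply: m_min; rewrite maxE scaled_intr_le.
move: m_ok; rewrite maxE sumE !scaled_intr_le => m_ok.
have [] := min_euclidean_oct _ ab_neq0.
rewrite gaussIntE aE bE; move: (min_euclidean _) => e.
rewrite (oct_valuation _ _ _ _ odd_xy) => -[leje xye] e_min.
have lem : (m <= e - 2 * j)%N by apply: m_min; move: xye; rewrite /in_oct; lia.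
case: ifPn => [le_sum | nle_sum].
  apply/eqP; rewrite eqn_leq; apply/andP; split; last by lia.
  apply: e_min; rewrite oct_valuation // addnK leq_addl; split=> //.
  by move: m_ok le_sum; rewrite /in_oct; lia.
apply/eqP; rewrite eqn_leq; apply/andP; split.
  (* One level higher always suffices: |x| + |y| <= 2(w_m - 2) = w_(m+2) - 4. *)
  apply: e_min; rewrite oct_valuation // addnAC addnK leq_addl addn1; split=> //.
  have [t t0 tw] := w_cases m.
  by move: m_ok; rewrite /in_oct wSS; lia.
rewrite addn1 ltn_neqAle; apply/andP; split; last by lia.
apply: contra nle_sum => /eqP eE; move: xye; rewrite -eE addnK /in_oct.
by lia.
Qed.
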